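(* Let $P_{k-1}$, $(h_k^i)_{i}$ and the other data be as in the context, and assume that there is at least one sensor $i\in\mathcal S$ with $h_k^i p_{\max}^i/\sigma^2\ge\theta_i$. Then the optimization problem (Problem 1) $$\begin{aligned}\min_{\boldsymbol\gamma_k,\boldsymbol p_k}\quad & \mathrm{Tr}\{P_k\}\\ \text{s.t.}\quad & \frac{h_k^i p_k^i}{\sum_{j\neq i}h_k^jp_k^j+\sigma^2}\ge\gamma_k^i\theta_i,\quad\forall i\in\mathcal S,\\ & p_k^i\in[0,p_{\max}^i],\quad\forall i\in\mathcal S,\\ & \gamma_k^i\in\{0,1\},\quad\forall i\in\mathcal S,\\ & P_k=P_{k|k-1}-K_k\tilde C_kP_{k|k-1},\\ & K_k=P_{k|k-1}\tilde C_k^T\big(\tilde C_kP_{k|k-1}\tilde C_k^T+\tilde R_k\big)^{\dagger}\end{aligned}$$ is equivalent to the optimization problem (Problem 2) $$\begin{aligned}\min_{\boldsymbol\gamma_k,\boldsymbol p_k,P_k}\quad & \mathrm{Tr}\{P_k\}\\ \text{s.t.}\quad & \begin{bmatrix}(AP_{k-1}A^T+Q)^{-1}+\sum_{i=1}^N\gamma_k^iC_i^TR_i^{-1}C_i & I\\ I & P_k\end{bmatrix}\ge 0,\\ & \frac{h_k^i p_k^i}{\sum_{j\neq i}h_k^jp_k^j+\sigma^2}\ge\gamma_k^i\theta_i,\quad\forall i\in\mathcal S,\\ & p_k^i\in[0,p_{\max}^i],\quad\forall i\in\mathcal S,\\ & \gamma_k^i\in\{0,1\},\quad\forall i\in\mathcal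 S.\end{aligned}$$ Here equivalence means: the two problems have the same optimal value, and $(\boldsymbol\gamma_k,\boldsymbol p_k)$ is optimal for Problem 1 if and only if there is a symmetric $P_k\in\mathbb R^{n\times n}$ such that $(\boldsymbol\gamma_k,\boldsymbol p_k,P_k)$ is optimal for Problem 2.
   Context: Fix a time $k$ and a set of sensors $\mathcal S=\{1,\dots,N\}$. Data: $A\in\mathbb R^{n\times n}$; $Q\in\mathbb R^{n\times n}$ symmetric, $Q\ge0$; for each sensor $i$, $C_i\in\mathbb R^{m_i\times n}$ and a symmetric $R_i\in\mathbb R^{m_i\times m_i}$ with $R_i>0$. The pairs $(A,C_i)$ are observable and $(A,Q^{1/2})$ is controllable. $P_{k-1}\in\mathbb R^{n\times n}$ is a given symmetric positive semidefinite matrix (the previous estimation error covariance), and $P_{k|k-1}:=AP_{k-1}A^T+Q$, assumed invertible. The channel gains $h_k^i>0$, noise power $\sigma^2>0$, QoS thresholds $\theta_i>0$ and power budgets $p_{\max}^i>0$ are given real numbers. Decision variables: $\boldsymbol\gamma_k=[\gamma_k^1,\dots,\gamma_k^N]$, $\boldsymbol p_k=[p_k^1,\dots,p_k^N]$, and, in Problem 2, also a symmetric matrix $P_k\in\mathbb R^{n\times n}$. For given $\boldsymbol\gamma_k$, $$\tilde C_k:=(\gamma_k^1C_1^T,\dots,\gamma_k^NC_N^T)^T,\qquad \tilde R_k:=\mathrm{diag}\{\gamma_k^1R_1,\dots,\gamma_k^NR_N\}$$ (block diagonal). $\dagger$ denotes the Moore–Penrose pseudo-inverse. For symmetric matrices,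 $X\ge0$ ($X>0$) means positive semidefinite (positive definite). *)

(* Defs.v *)
From HB Require Import structures.
From mathcomp Require Import all_boot all_order all_algebra.
From mathcomp Require Import boolp classical_sets reals constructive_ereal ereal.

Set Implicit Arguments.
Unset Strict Implicit.
Unset Printing Implicit Defensive.

Import Order.TTheory GRing.Theory Num.Theory.
Local Open Scope classical_set_scope.
Local Open Scope ring_scope.

Section LinearAlgebra.
Variable R : realType.

Definition symmetric_mx n (X : 'M[R]_n) : Prop := X^T = X.

Definition psd_mx n (X : 'M[R]_n) : Prop :=
  symmetric_mx X /\ forall x : 'cV[R]_n, 0 <= (x^T *m X *m x) 0 0.

Definition pd_mx n (X : 'M[R]_n) : Prop :=
  symmetric_mx X /\
  forall x : 'cV[R]_n, x != 0 -> 0 < (x^T *m X *m x) 0 0.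

Definition moore_penrose m n (M : 'M[R]_(m, n)) (X : 'M[R]_(n, m)) : Prop :=
  [/\ M *m X *m M = M, X *m M *m X = X,
      (M *m X)^T = M *m X & (X *m M)^T = X *m M].

(* Well defined by [moore_penrose_ex] and [moore_penrose_uniq]; the default
   value 0 is never used. The function [pinvmx] of
   mxalgebra is only a generalized inverse, not the Moore-Penrose one. *)
Definition mp_pinv m n (M : 'M[R]_(m, n)) : 'M[R]_(n, m) :=
  xget 0 [set X | moore_penrose M X].

(* Kalman rank conditions. *)
Definition observable n m (A : 'M[R]_n) (C : 'M[R]_(m, n)) : Prop :=
  \rank (\mxcol_(j < n) (C *m A ^+ j)) = n.

Definition controllable n m (A : 'M[R]_n) (B : 'M[R]_(n, m)) : Prop :=
  \rank (\mxrow_(j < n) (A ^+ j *m B)) = n.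

Lemma trmul_eq0 n (x : 'rV[R]_n) : x *m x^T = 0 -> x = 0.
Proof.
move/matrixP/(_ 0 0); rewrite !mxE => /eqP; rewrite psumr_eq0; last first.
  by move=> i _; rewrite mxE -expr2 sqr_ge0.
move=> /allP x0; apply/rowP => i; rewrite mxE.
have := x0 i (mem_index_enum i); rewrite /= mxE mulf_eq0 orbb.
by move/eqP.
Qed.

Lemma gram_unit m n (G : 'M[R]_(m, n)) : row_free G -> G *m G^T \in unitmx.
Proof.
move=> Gfree; rewrite -row_free_unit; apply/inj_row_free => v vGG0.
have /trmul_eq0 vG0 : (v *m G) *m (v *m G)^T = 0.
  by rewrite trmx_mul !mulmxA -(mulmxA v) vGG0 mul0mx.
by apply: (row_free_inj Gfree); rewrite vG0 mul0mx.
Qed.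

Lemma moore_penrose_factor m r n (F : 'M[R]_(m, r)) (G : 'M[R]_(r, n)) :
  row_full F -> row_free G -> exists X, moore_penrose (F *m G) X.
Proof.
move=> Ffull Gfree.
have uG : G *m G^T \in unitmx by exact: gram_unit.
have uF : F^T *m F \in unitmx.
  rewrite -{2}(trmxK F); apply: gram_unit.
  by rewrite /row_free mxrank_tr.
pose a := invmx (G *m G^T); pose b := invmx (F^T *m F).
have aT : a^T = a by rewrite /a trmx_inv trmx_mul trmxK.
have bT : b^T = b by rewrite /b trmx_inv trmx_mul trmxK.
have aG : G *m G^T *m a = 1%:M by exact: mulmxV.
have bF : b *m (F^T *m F) = 1%:M by exact: mulVmx.
pose X := G^T *m a *m b *m F^T.
have MX : F *m G *m X = F *m b *m F^T.
  have -> : F *m G *m X = F *m (G *m G^T *m a) *m b *m F^T.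
    by rewrite /X !mulmxA.
  by rewrite aG mulmx1.
have XM : X *m (F *m G) = G^T *m a *m G.
  have -> : X *m (F *m G) = G^T *m a *m (b *m (F^T *m F)) *m G.
    by rewrite /X !mulmxA.
  by rewrite bF mulmx1.
exists X; split.
- rewrite MX.
  have -> : F *m b *m F^T *m (F *m G) = F *m (b *m (F^T *m F)) *m G.
    by rewrite !mulmxA.
  by rewrite bF mulmx1.
- rewrite XM.
  have -> : G^T *m a *m G *m X = G^T *m a *m (G *m G^T *m a) *m b *m F^T.
    by rewrite /X !mulmxA.
  by rewrite aG mulmx1.
- by rewrite MX !trmx_mul trmxK bT mulmxA.
- by rewrite XM !trmx_mul trmxK aT mulmxA.
Qed.

Lemma moore_penrose_ex m n (M : 'M[R]_(m, n)) : exists X, moore_penrose M X.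
Proof.
have [|X] := @moore_penrose_factor _ _ _ (col_base M) (row_base M) _
  (row_base_free M); first exact: col_base_full.
by rewrite mulmx_base; exists X.
Qed.

Lemma moore_penrose_uniq m n (M : 'M[R]_(m, n)) X Y :
  moore_penrose M X -> moore_penrose M Y -> X = Y.
Proof.
case=> [MXM XMX MXT XMT] [MYM YMY MYT YMT].
have e1 : M *m X = M *m Y.
  by rewrite -MXT -{1}MYM -(mulmxA (M *m Y)) trmx_mul MXT MYT mulmxA MXM.
have e2 : X *m M = Y *m M.
  have -> : X *m M = (X *m M *m (Y *m M)).
    by rewrite -mulmxA (mulmxA M) MYM.
  by rewrite -XMT -YMT -trmx_mul -mulmxA (mulmxA M) MXM.
by rewrite -XMX -mulmxA e1 mulmxA e2 YMY.
Qed.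

Lemma mp_pinvP m n (M : 'M[R]_(m, n)) : moore_penrose M (mp_pinv M).
Proof. exact: (xgetPex 0 (moore_penrose_ex M)). Qed.

End LinearAlgebra.

Section Optimization.
Variables (R : realType) (T : Type).

Definition optimal_value (feasible : set T) (cost : T -> R) : \bar R :=
  ereal_inf [set (cost x)%:E | x in feasible].

Definition optimal (feasible : set T) (cost : T -> R) (x : T) : Prop :=
  feasible x /\ forall y, feasible y -> cost x <= cost y.

End Optimization.

Section Scheduling.
Variables (R : realType) (n N : nat) (m : 'I_N -> nat).
Variables (A Q P0 : 'M[R]_n).
Variables (C : forall i : 'I_N, 'M[R]_(m i, n)) (V : forall i : 'I_N, 'M[R]_(m i)).
Variables (h theta pmax : 'I_N -> R) (sigma : R).

(* P0 is the previous error covariance P_{k-1}, prior_cov is P_{k|k-1}, V i is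
   the measurement noise covariance R_i of sensor i. *)
Definition prior_cov : 'M[R]_n := A *m P0 *m A^T + Q.

Definition stacked_C (gamma : 'rV[R]_N) : 'M[R]_(\sum_i m i, n) :=
  \mxcol_i (gamma 0 i *: C i).

Definition stacked_V (gamma : 'rV[R]_N) : 'M[R]_(\sum_i m i) :=
  \mxdiag_i (gamma 0 i *: V i).

Definition gain (gamma : 'rV[R]_N) : 'M[R]_(n, \sum_i m i) :=
  prior_cov *m (stacked_C gamma)^T
  *m mp_pinv (stacked_C gamma *m prior_cov *m (stacked_C gamma)^T
              + stacked_V gamma).

Definition posterior_cov (gamma : 'rV[R]_N) : 'M[R]_n :=
  prior_cov - gain gamma *m stacked_C gamma *m prior_cov.

Definition sinr (p : 'rV[R]_N) (i : 'I_N) : R :=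
  h i * p 0 i / (\sum_(j < N | j != i) h j * p 0 j + sigma ^+ 2).

Definition admissible (gamma p : 'rV[R]_N) : Prop :=
  [/\ forall i, gamma 0 i * theta i <= sinr p i,
      forall i, 0 <= p 0 i <= pmax i &
      forall i, gamma 0 i = 0 \/ gamma 0 i = 1].

Definition lmi_mx (gamma : 'rV[R]_N) (P : 'M[R]_n) : 'M[R]_(n + n) :=
  block_mx
    (invmx prior_cov
     + \sum_(i < N) gamma 0 i *: ((C i)^T *m invmx (V i) *m C i))
    1%:M
    1%:M
    P.

(* In the first problem the equality constraints determine K_k and P_k from
   gamma: they are [gain] and [posterior_cov], substituted in the cost. *)
Definition feasible1 : set ('rV[R]_N * 'rV[R]_N) :=
  [set x | admissible x.1 x.2].

Definition cost1 (x : 'rV[R]_N * 'rV[R]_N) : R := \tr (posterior_cov x.1).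

Definition feasible2 : set ('rV[R]_N * 'rV[R]_N * 'M[R]_n) :=
  [set x | [/\ symmetric_mx x.2, psd_mx (lmi_mx x.1.1 x.2)
             & admissible x.1.1 x.1.2]].

Definition cost2 (x : 'rV[R]_N * 'rV[R]_N * 'M[R]_n) : R := \tr x.2.

End Scheduling.

(* Main.v *)
Require Import Defs.
From mathcomp Require Import all_boot all_order all_algebra.
From mathcomp Require Import boolp classical_sets reals constructive_ereal ereal.

From mathcomp Require Import ring.

Import Order.TTheory GRing.Theory Num.Theory.
Local Open Scope ring_scope.

(* With Y the upper left block of the linear matrix inequality, a singular
   version of the Woodbury identity shows that the posterior covariance P(gamma)
   is Y^-1: the vanishing rows of the unscheduled sensors are harmless because
   the kernel of the innovation covariance is contained in that of C~^T. The
   Schur complement turns the inequality into P >= P(gamma), so P(gamma) is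
   feasible in the second problem and has the least trace for given gamma. *)

(** * Positive semidefinite matrices, the singular Woodbury identity and Schur complements *)

Section PositiveSemidefinite.
Context {R : realType}.

Lemma psd_add {n} (X Y : 'M[R]_n) : psd_mx X -> psd_mx Y -> psd_mx (X + Y).
Proof.
move=> [Xs X0] [Ys Y0]; split; first by rewrite /symmetric_mx linearD /= Xs Ys.
by move=> x; rewrite mulmxDr mulmxDl mxE addr_ge0.
Qed.

Lemma psd0 {n} : psd_mx (0 : 'M[R]_n).
Proof.
by split=> [|x]; [rewrite /symmetric_mx trmx0 | rewrite mulmx0 mul0mx mxE].
Qed.

Lemma psd_scale {n} (a : R) (X : 'M[R]_n) :
  0 <= a -> psd_mx X -> psd_mx (a *: X).
Proof.
move=> a0 [Xs X0]; split; first by rewrite /symmetric_mx linearZ /= Xs.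
by move=> x; rewrite -scalemxAr -scalemxAl mxE mulr_ge0.
Qed.

Lemma psd_sum {n} (I : finType) (X : I -> 'M[R]_n) :
  (forall i, psd_mx (X i)) -> psd_mx (\sum_i X i).
Proof.
by move=> X0; apply: big_ind => // [|? ?]; [exact: psd0 | exact: psd_add].
Qed.

Lemma psd_congr {n m} (X : 'M[R]_n) (B : 'M[R]_(n, m)) :
  psd_mx X -> psd_mx (B^T *m X *m B).
Proof.
move=> [Xs X0]; split; first by rewrite /symmetric_mx !trmx_mul trmxK Xs mulmxA.
move=> x; have := X0 (B *m x); rewrite trmx_mul.
by rewrite !mulmxA.
Qed.

(** By symmetry the inverse is the congruence of [X] by [invmx X]. *)
Lemma psd_inv {n} (X : 'M[R]_n) :
  X \in unitmx -> psd_mx X -> psd_mx (invmx X).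
Proof.
move=> uX psdX; have := psd_congr _ (invmx X) psdX.
by rewrite trmx_inv psdX.1 mulVmx // mul1mx.
Qed.

Lemma pd_unit {n} (X : 'M[R]_n) : pd_mx X -> X \in unitmx.
Proof.
move=> [Xs X0]; rewrite -row_free_unit; apply/inj_row_free => v vX0.
apply/eqP; apply: contraT => v0.
have : v^T != 0 by rewrite -trmx0 (inj_eq (@trmx_inj _ _ _)).
by move/X0; rewrite trmxK vX0 mul0mx mxE ltxx.
Qed.

Lemma pd_psd {n} (X : 'M[R]_n) : pd_mx X -> psd_mx X.
Proof.
move=> [Xs X0]; split=> // x; have [->|/X0/ltW//] := eqVneq x 0.
by rewrite mulmx0 mxE.
Qed.

(** A zero of a nonnegative form is a minimum, so the first variation in the direction [X *m x],
    twice the squared norm of [X *m x], must vanish. *)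
Lemma psd_ker {n} (X : 'M[R]_n) (x : 'cV[R]_n) :
  psd_mx X -> (x^T *m X *m x) 0 0 = 0 -> X *m x = 0.
Proof.
move=> [Xs X0] x0; pose y := X *m x.
have xXE : x^T *m X = y^T by rewrite /y trmx_mul Xs.
set a := (y^T *m y) 0 0; set c := (y^T *m X *m y) 0 0.
have c0 : 0 <= c by exact: X0.
(* Expand the form at x + t X x, then take t = - a / (c + 1). *)
have pos t : 0 <= t * a *+ 2 + t ^+ 2 * c.
  have := X0 (x + t *: y).
  have -> : (x + t *: y)^T = x^T + t *: y^T by rewrite linearD linearZ.
  rewrite !(mulmxDl, mulmxDr).
  rewrite -!scalemxAl -!scalemxAr scalerA.
  rewrite -[y^T *m X *m x]mulmxA -/y xXE.
  have entD (u v : 'M[R]_1) : (u + v) 0 0 = u 0 0 + v 0 0 by rewrite mxE.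
  have entZ k (u : 'M[R]_1) : (k *: u) 0 0 = k * u 0 0 by rewrite mxE.
  rewrite !entD !entZ -xXE x0 xXE add0r -/a -/c.
  by rewrite addrA -mulr2n expr2.
have a0 : a = 0.
  (* The shift by 1 keeps the denominator positive even when [c] is 0. *)
  have c1 : 0 < c + 1 by rewrite ltr_wpDl.
  have := pos (- a / (c + 1)).
  have -> : - a / (c + 1) * a *+ 2 + (- a / (c + 1)) ^+ 2 * c =
            - ((a / (c + 1)) ^+ 2 * (c + 2)) by field; rewrite gt_eqF.
  rewrite oppr_ge0 pmulr_lle0 ?ltr_wpDl // => a2.
  have /eqP : (a / (c + 1)) ^+ 2 = 0 by apply/eqP; rewrite eq_le a2 sqr_ge0.
  by rewrite sqrf_eq0 mulf_eq0 invr_eq0 (gt_eqF c1) orbF => /eqP.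
rewrite -/y -[y]trmxK; apply/eqP; rewrite -trmx0 (inj_eq (@trmx_inj _ _ _)).
apply/eqP/trmul_eq0; rewrite trmxK; apply/matrixP => i j.
by rewrite !ord1 [LHS]a0 mxE.
Qed.

Lemma psd_mxdiag {N} (m : 'I_N -> nat) (X : forall i, 'M[R]_(m i)) :
  (forall i, psd_mx (X i)) -> psd_mx (\mxdiag_i X i).
Proof.
move=> X0; split.
  by rewrite /symmetric_mx tr_mxdiag; apply: eq_mxdiag => i; rewrite (X0 i).1.
move=> x; rewrite -(submxcolK x) -mulmxA mul_mxdiag_mxcol tr_mxcol.
rewrite mul_mxrow_mxcol summxE; apply: sumr_ge0 => i _.
by rewrite mulmxA (X0 i).2.
Qed.

(** If [M *m x = 0], both nonnegative terms of the form of [M] vanish at [x]; as [S] is invertible,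
    [psd_ker] then gives [H^T *m x = 0]. So [H^T] factors through the projection
    [mp_pinv M *m M]. *)
Lemma psd_innovation_range {n m} (S : 'M[R]_n) (H : 'M[R]_(m, n)) (U : 'M[R]_m) :
  psd_mx S -> S \in unitmx -> psd_mx U ->
  let M := H *m S *m H^T + U in H^T *m mp_pinv M *m M = H^T.
Proof.
move=> S0 uS U0 M; have [MXM _ _ _] := mp_pinvP M.
have HSH0 : psd_mx (H *m S *m H^T).
  by have := psd_congr S H^T S0; rewrite trmxK.
have ker (x : 'cV_m) : M *m x = 0 -> H^T *m x = 0.
  move=> Mx0.
  have : (x^T *m M *m x) 0 0 = 0 by rewrite -mulmxA Mx0 mulmx0 mxE.
  rewrite mulmxDr mulmxDl mxE => /eqP.
  rewrite paddr_eq0 ?(HSH0.2, U0.2) // => /andP[/eqP xHSHx _].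
  have : S *m (H^T *m x) = 0.
    by apply: psd_ker => //; rewrite trmx_mul trmxK !mulmxA -xHSHx !mulmxA.
  by move/(congr1 (mulmx (invmx S))); rewrite mulKmx // mulmx0.
apply/eqP; rewrite -subr_eq0 -mulmxA -{2}[H^T]mulmx1 -mulmxBr; apply/eqP.
(* Every column of [Z], which is [mp_pinv M *m M - 1], lies in the kernel of [M]. *)
set Z := _ - _; have MZ0 : M *m Z = 0 by rewrite mulmxBr mulmx1 mulmxA MXM subrr.
apply/matrixP => i j; have : H^T *m (Z *m delta_mx j 0 : 'cV_m) = 0.
  by apply: ker; rewrite mulmxA MZ0 mul0mx.
by rewrite mulmxA -colE => /colP/(_ i); rewrite !mxE.
Qed.

(** [W] need invert [U] only on the range of [H]. Then [H + H S H^T W H = M W H], and absorbing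
    [mp_pinv M *m M] into [H^T] makes the correction term cancel [S H^T W H]. *)
Lemma singular_woodbury {n m} (S : 'M[R]_n) (H : 'M[R]_(m, n)) (U W : 'M[R]_m) :
  psd_mx S -> S \in unitmx -> psd_mx U -> U *m W *m H = H ->
  (S - S *m H^T *m mp_pinv (H *m S *m H^T + U) *m H *m S)
    *m (invmx S + H^T *m W *m H) = 1%:M.
Proof.
move=> S0 uS U0 UWH; have HXM := psd_innovation_range S H U S0 uS U0.
move: HXM; set M := _ + U; set X := mp_pinv M => HXM.
have E : H + H *m S *m (H^T *m W *m H) = M *m W *m H.
  by rewrite /M !mulmxDl UWH !mulmxA addrC.
rewrite mulmxBl mulmxDr mulmxV //.
have -> : S *m H^T *m X *m H *m S *m (invmx S + H^T *m W *m H)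
        = S *m H^T *m X *m (H + H *m S *m (H^T *m W *m H)).
  by rewrite !mulmxDr !mulmxA mulmxK.
rewrite E.
have -> : S *m H^T *m X *m (M *m W *m H) = S *m (H^T *m X *m M) *m W *m H.
  by rewrite !mulmxA.
by rewrite HXM !mulmxA addrK.
Qed.

(** The block matrix is the congruence of [Y] by the row of blocks [1] and [invmx Y]. *)
Lemma schur_psd {n} (Y : 'M[R]_n) :
  psd_mx Y -> Y \in unitmx -> psd_mx (block_mx Y 1%:M 1%:M (invmx Y)).
Proof.
move=> Y0 uY.
have := psd_congr Y (row_mx 1%:M (invmx Y)) Y0.
rewrite tr_row_mx trmx1 trmx_inv Y0.1 mul_col_mx mul1mx mulVmx //.
by rewrite mul_col_row !mulmx1 !mul1mx mulmxV.
Qed.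

Lemma psd_trace {n} (X : 'M[R]_n) : psd_mx X -> 0 <= \tr X.
Proof.
move=> [_ X0]; apply: sumr_ge0 => i _; have := X0 (delta_mx i 0).
by rewrite trmx_delta -rowE -colE !mxE.
Qed.

(** Congruence by the column of blocks [- invmx Y] and [1] leaves [P - invmx Y], whose trace is
    therefore nonnegative. *)
Lemma schur_trace {n} (Y P : 'M[R]_n) :
  symmetric_mx Y -> Y \in unitmx -> psd_mx (block_mx Y 1%:M 1%:M P) ->
  \tr (invmx Y) <= \tr P.
Proof.
move=> Ys uY YP0; rewrite -subr_ge0 -linearB; apply: psd_trace.
have := psd_congr _ (col_mx (- invmx Y) 1%:M) YP0.
rewrite -mulmxA mul_block_col tr_col_mx mul_row_col trmx1 linearN /= trmx_inv Ys.
by rewrite mulmxN mulmxV // mulmx1 addNr mulmx0 add0r !mul1mx mulmx1 addrC.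
Qed.

End PositiveSemidefinite.

(** * The posterior covariance as inverse of the information matrix *)

Section Scheduling.
Context {R : realType} {n N : nat} {m : 'I_N -> nat}.
Variables (A Q P0 : 'M[R]_n).
Variables (C : forall i : 'I_N, 'M[R]_(m i, n)).
Variables (V : forall i : 'I_N, 'M[R]_(m i)) (gamma : 'rV[R]_N).
Hypothesis V_pd : forall i, pd_mx (V i).
Hypothesis prior_psd : psd_mx (prior_cov A Q P0).
Hypothesis prior_unit : prior_cov A Q P0 \in unitmx.
Hypothesis gamma01 : forall i, gamma 0 i = 0 \/ gamma 0 i = 1.

Let Y : 'M[R]_n := invmx (prior_cov A Q P0)
  + \sum_(i < N) gamma 0 i *: ((C i)^T *m invmx (V i) *m C i).

(** In [H^T W H] below each sensor carries the cube of its scheduling bit, while [Y] has the bit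
    itself. *)
Lemma gamma_idem i : gamma 0 i * gamma 0 i = gamma 0 i.
Proof. by case: (gamma01 i) => ->; rewrite ?mulr0 ?mulr1. Qed.

Lemma information_psd : psd_mx Y.
Proof.
apply: psd_add; first exact: psd_inv.
apply: psd_sum => i; apply: psd_scale.
  by case: (gamma01 i) => ->.
apply: psd_congr; apply: psd_inv; [exact: pd_unit | exact: pd_psd].
Qed.

Lemma posterior_information : posterior_cov A Q P0 C V gamma *m Y = 1%:M.
Proof.
pose H := stacked_C C gamma.
(* A generalized inverse of [stacked_V]: scheduled blocks are inverted, the others stay zero, where
   [H] vanishes too. *)
pose W : 'M[R]_(\sum_i m i) := \mxdiag_i (gamma 0 i *: invmx (V i)).
have WH : W *m H = \mxcol_i (gamma 0 i *: (invmx (V i) *m C i)).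
  rewrite mul_mxdiag_mxcol; apply: eq_mxcol => i.
  by rewrite -scalemxAl -scalemxAr scalerA gamma_idem.
have UWH : stacked_V V gamma *m W *m H = H.
  rewrite -mulmxA WH mul_mxdiag_mxcol; apply: eq_mxcol => i.
  by rewrite -scalemxAl -scalemxAr scalerA gamma_idem mulKVmx // pd_unit.
have HWH : H^T *m W *m H
    = \sum_(i < N) gamma 0 i *: ((C i)^T *m invmx (V i) *m C i).
  rewrite -mulmxA WH tr_mxcol mul_mxrow_mxcol; apply: eq_bigr => i _.
  by rewrite -scalemxAr [(_ *: _)^T]linearZ -scalemxAl scalerA gamma_idem mulmxA.
rewrite /Y -HWH /posterior_cov /gain; apply: singular_woodbury => //.
apply: psd_mxdiag => i; apply: psd_scale; last exact: pd_psd.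
by case: (gamma01 i) => ->.
Qed.

(** A one-sided inverse of a square matrix suffices. *)
Lemma information_unit : Y \in unitmx.
Proof. by have /mulmx1_unit[] := posterior_information. Qed.

Lemma posterior_covE : posterior_cov A Q P0 C V gamma = invmx Y.
Proof.
by rewrite -[LHS](mulmxK information_unit) posterior_information mul1mx.
Qed.

Lemma lmi_trace P : psd_mx (lmi_mx A Q P0 C V gamma P) ->
  \tr (posterior_cov A Q P0 C V gamma) <= \tr P.
Proof.
rewrite posterior_covE; apply: schur_trace; last exact: information_unit.
exact: information_psd.1.
Qed.

Lemma lmi_posterior :
  psd_mx (lmi_mx A Q P0 C V gamma (posterior_cov A Q P0 C V gamma)).
Proof.
rewrite posterior_covE; apply: schur_psd; last exact: information_unit.
exact: information_psd.
Qed.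

Lemma posterior_symmetric : symmetric_mx (posterior_cov A Q P0 C V gamma).
Proof.
by rewrite posterior_covE; apply: (psd_inv _ information_unit information_psd).1.
Qed.

End Scheduling.

(** * Equivalence of the two optimization problems *)

Theorem proposition1 (R : realType) (n N : nat) (m : 'I_N -> nat)
  (A Q Qhalf P0 : 'M[R]_n)
  (C : forall i : 'I_N, 'M[R]_(m i, n)) (V : forall i : 'I_N, 'M[R]_(m i))
  (h theta pmax : 'I_N -> R) (sigma : R)
  (Q_psd : psd_mx Q)
  (Qhalf_psd : psd_mx Qhalf) (Qhalf_sqr : Qhalf *m Qhalf = Q)
  (V_pd : forall i, pd_mx (V i))
  (AC_obs : forall i, observable A (C i))
  (AQ_ctr : controllable A Qhalf)
  (P0_psd : psd_mx P0)
  (prior_unit : prior_cov A Q P0 \in unitmx)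
  (h_gt0 : forall i, 0 < h i)
  (sigma2_gt0 : 0 < sigma ^+ 2)
  (theta_gt0 : forall i, 0 < theta i)
  (pmax_gt0 : forall i, 0 < pmax i)
  (some_sensor : exists i, theta i <= h i * pmax i / sigma ^+ 2) :
  let F1 := feasible1 h theta pmax sigma in
  let J1 := cost1 A Q P0 C V in
  let F2 := feasible2 A Q P0 C V h theta pmax sigma in
  let J2 := @cost2 R n N in
  optimal_value F1 J1 = optimal_value F2 J2 /\
  (forall gamma p : 'rV[R]_N,
     optimal F1 J1 (gamma, p) <->
     exists P : 'M[R]_n,
       symmetric_mx P /\ optimal F2 J2 (gamma, p, P)).
Proof.
move=> F1 J1 F2 J2.
have S0 : psd_mx (prior_cov A Q P0).
  apply: psd_add => //; have := psd_congr P0 A^T P0_psd.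
  by rewrite trmxK.
(* Forgetting [P] keeps feasibility and does not raise the cost. *)
have F21 g p P : F2 (g, p, P) -> F1 (g, p) /\ J1 (g, p) <= J2 (g, p, P).
  move=> [/= _ lmi adm]; split => //.
  by apply: lmi_trace lmi => //; case: adm.
(* Conversely, completing by the posterior covariance keeps feasibility and leaves the cost
   unchanged by definition. *)
pose post (g : 'rV[R]_N) := posterior_cov A Q P0 C V g.
have F12 g p : F1 (g, p) -> F2 (g, p, post g).
  move=> adm; have [_ _ g01] := adm; split => //=.
    exact: posterior_symmetric.
  exact: lmi_posterior.
split.
  apply/eqP; rewrite eq_le; apply/andP; split.
    apply: le_ereal_inf_tmp => _ [[[g p] P] /F21[Fgp le_J] <-].
    by apply: ge_ereal_inf; exists (J1 (g, p))%:E; [exists (g, p) | rewrite lee_fin].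
  apply: le_ereal_inf_tmp => _ [[g p] /F12 Fgp <-].
  by apply: ereal_inf_lbound; exists (g, p, post g).
move=> g p; split=> [[Fgp opt]|[P [_ [/F21[Fgp le_J] opt]]]].
  exists (post g); split; first by have [] := F12 _ _ Fgp.
  split=> [|[[g' p'] P'] /F21[F' le_J]]; first exact: F12.
  exact: le_trans (opt _ F') le_J.
(* A competitor of Problem 1, completed by its posterior covariance, costs at least the trace of
   [P], which bounds the cost of [(g, p)]. *)
split=> // -[g' p'] /F12/opt; exact: le_trans.
Qed.
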